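(* For every $n\in\mathbb{N}$ and every $\eta\in(0,1/2]$ there exists a constant $k(n,\eta)>0$, depending only on $n$ and $\eta$, with the following property. Let $\omega$ be a modulus of continuity, let $C\subseteq\mathbb{R}^n$ be a (not necessarily convex) subset, let $f:C\to\mathbb{R}$ be an arbitrary function, and let $G:C\to\mathbb{R}^n$ be a nonconstant mapping which has modulus of continuity $\omega$. Let $M=M(G,C):=\sup_{x,y\in C,\,x\neq y}\frac{|G(x)-G(y)|}{\omega(|x-y|)}$ and assume that $$f(x)-f(y)-\langle G(y),x-y\rangle\ \geq\ \eta\,|G(x)-G(y)|\,\omega^{-1}\!\left(\frac{1}{2M}|G(x)-G(y)|\right)\quad\text{for all }x,y\in C.$$ Then there exists a convex function $F\in C^{1,\omega}(\mathbb{R}^n)$ with $F=f$ on $C$, $\nabla F=G$ on $C$, and $$\sup_{x,y\in\mathbb{R}^n,\,x\neq y}\frac{|\nabla F(x)-\nabla F(y)|}{\omega(|x-y|)}\ \leq\ k(n,\eta)\,M(G,C).$$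
   Context: A modulus of continuity is a concave, strictly increasing function $\omega:[0,\infty)\to[0,\infty)$ with $\omega(0^+)=0$; its inverse is $\omega^{-1}:[0,\beta)\to[0,\infty)$, where $\beta=\sup\omega\in(0,\infty]$. A mapping $G$ has modulus of continuity $\omega$ if there is $M\ge 0$ with $|G(x)-G(y)|\le M\,\omega(|x-y|)$ for all $x,y$. $C^{1,\omega}(\mathbb{R}^n)$ is the set of $C^1$ functions $F:\mathbb{R}^n\to\mathbb{R}$ (not required to be bounded) whose gradient has modulus of continuity $\omega$. *)

(* Defs.v *)
From HB Require Import structures.
From mathcomp Require Import all_boot all_order all_algebra.
From mathcomp Require Import all_classical all_reals all_analysis.

Set Implicit Arguments.
Unset Strict Implicit.
Unset Printing Implicit Defensive.

Import Order.TTheory GRing.Theory Num.Theory numFieldNormedType.Exports.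

Local Open Scope classical_set_scope.
Local Open Scope ring_scope.

(* The library norm `|x| on 'rV[R]_n is the sup norm, whence a separate
   Euclidean norm. The two induce the same topology and the same notion of
   differentiability, so continuous and differentiable are the library's. *)
Definition dotv (R : realType) (n : nat) (u v : 'rV[R]_n) : R :=
  \sum_(i < n) u 0 i * v 0 i.

Definition enorm (R : realType) (n : nat) (u : 'rV[R]_n) : R :=
  Num.sqrt (dotv u u).

(* Only the values of omega on [0, +oo[ matter. The condition omega 0 = 0 is
   not listed: it follows from the last three. *)
Definition modulus_of_continuity (R : realType) (omega : R -> R) : Prop :=
  [/\ convex_function (`[0, +oo[ : set R) (fun t : R => - omega t),
      {in `[0, +oo[ &, {homo omega : s t / s < t}},
      (forall t, 0 <= t -> 0 <= omega t) &
      omega t @[t --> 0^'+] --> (0 : R)].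

(* The inverse of omega restricted to [0, +oo[; it has the junk value 0 outside
   of the image of that interval, which is [0, sup omega[. *)
Definition modulus_inv (R : realType) (omega : R -> R) : R -> R :=
  'pinv_(fun=> 0) `[0, +oo[ omega.

Definition has_modulus (R : realType) (n : nat) (omega : R -> R)
    (C : set 'rV[R]_n) (G : 'rV[R]_n -> 'rV[R]_n) : Prop :=
  exists2 M : R, 0 <= M &
    forall x y, C x -> C y -> enorm (G x - G y) <= M * omega (enorm (x - y)).

(* M(G, C), as an extended real so that it is the true supremum even when the
   ratios are unbounded. *)
Definition modulus_seminorm (R : realType) (n : nat) (omega : R -> R)
    (C : set 'rV[R]_n) (G : 'rV[R]_n -> 'rV[R]_n) : \bar R :=
  ereal_sup [set r | exists x y, [/\ C x, C y, x != y &
    r = (enorm (G x - G y) / omega (enorm (x - y)))%:E]].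

Definition gradient (R : realType) (n : nat) (F : 'rV[R]_n -> R)
    (x : 'rV[R]_n) : 'rV[R]_n :=
  \row_(i < n) 'D_(delta_mx 0 i) F x.

Definition C1_modulus (R : realType) (n : nat) (omega : R -> R)
    (F : 'rV[R]_n -> R) : Prop :=
  [/\ forall x, differentiable F x,
      continuous (gradient F) &
      has_modulus omega setT (gradient F)].

(* Main.v *)
Require Import Defs.
From HB Require Import structures.
From mathcomp Require Import all_boot all_order all_algebra.
From mathcomp Require Import all_classical all_reals all_analysis.
From mathcomp Require Import ring lra.

Set Implicit Arguments.
Unset Strict Implicit.
Unset Printing Implicit Defensive.

Import Order.TTheory GRing.Theory Num.Theory numFieldNormedType.Exports.

Local Open Scope classical_set_scope.
Local Open Scope ring_scope.

(** Put [K = 2 M / eta] and [Phi v = K |v| omega |v|]. The hypothesis on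
    [(f, G)] and a Young-type inequality show that every affine function
    [f z + <G z, x - z>] lies below every [f y + <G y, x - y> + Phi (x - y)],
    [y, z] in [C]. Let [F] be the largest convex function below all the latter.
    It lies above all the former, so it equals [f] on [C] and has [G] as a
    subgradient there. As [omega] is concave, the upper functions satisfy
    [u (x + h) + u (x - h) - 2 u x <= 8 K |h| omega |h|], and [F] inherits this
    bound. A convex function with such a bound has linear directional
    derivatives, whence it is differentiable, with a gradient of modulus
    [16 K omega]. The constant [32 / eta] does not depend on [n]. *)

(** * Euclidean inner product and norm, and their comparison with the sup norm *)

Section Euclidean.
Variables (R : realType) (n : nat).
Implicit Types (u v w : 'rV[R]_n) (a : R).

Lemma dotvC u v : dotv u v = dotv v u.
Proof. by apply: eq_bigr => i _; rewrite mulrC. Qed.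

Lemma dotvDr u v w : dotv u (v + w) = dotv u v + dotv u w.
Proof. by rewrite -big_split; apply: eq_bigr => i _; rewrite mxE mulrDr. Qed.

Lemma dotvZr a u v : dotv u (a *: v) = a * dotv u v.
Proof. by rewrite mulr_sumr; apply: eq_bigr => i _; rewrite mxE mulrCA. Qed.

Lemma dotvNr u v : dotv u (- v) = - dotv u v.
Proof. by rewrite -scaleN1r dotvZr mulN1r. Qed.

Lemma dotvDl u v w : dotv (u + v) w = dotv u w + dotv v w.
Proof. by rewrite dotvC dotvDr !(dotvC w). Qed.

Lemma dotvZl a u v : dotv (a *: u) v = a * dotv u v.
Proof. by rewrite dotvC dotvZr dotvC. Qed.

Lemma dotvNl u v : dotv (- u) v = - dotv u v.
Proof. by rewrite dotvC dotvNr dotvC. Qed.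

Lemma dotv_delta u i : dotv u (delta_mx 0 i) = u 0 i.
Proof.
rewrite /dotv (bigD1 i) //= big1 ?mxE ?eqxx ?mulr1 ?addr0 // => j ji.
by rewrite mxE (negbTE ji) andbF mulr0.
Qed.

Lemma dotvv_ge0 u : 0 <= dotv u u.
Proof. by apply: sumr_ge0 => i _; rewrite -expr2 sqr_ge0. Qed.

Lemma enorm_ge0 u : 0 <= enorm u.
Proof. exact: sqrtr_ge0. Qed.

Lemma sqr_enorm u : enorm u ^+ 2 = dotv u u.
Proof. by rewrite sqr_sqrtr ?dotvv_ge0. Qed.

Lemma enormZ a u : enorm (a *: u) = `|a| * enorm u.
Proof.
by rewrite /enorm dotvZl dotvZr mulrA -expr2 sqrtrM ?sqr_ge0 // sqrtr_sqr.
Qed.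

Lemma enormN u : enorm (- u) = enorm u.
Proof. by rewrite -scaleN1r enormZ normrN1 mul1r. Qed.

Lemma enorm0 : enorm (0 : 'rV[R]_n) = 0.
Proof. by rewrite -(scale0r 0) enormZ normr0 mul0r. Qed.

Lemma coord_le_enorm u i : `|u 0 i| <= enorm u.
Proof.
rewrite -sqrtr_sqr ler_wsqrtr // /dotv (bigD1 i) //= -expr2 lerDl.
by apply: sumr_ge0 => j _; rewrite -expr2 sqr_ge0.
Qed.

Lemma enorm_eq0 u : (enorm u == 0) = (u == 0).
Proof.
apply/eqP/eqP => [u0|->]; last exact: enorm0.
apply/rowP => i; rewrite mxE; apply/eqP.
by rewrite -normr_le0 -u0 coord_le_enorm.
Qed.

Lemma enorm_gt0 u : (0 < enorm u) = (u != 0).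
Proof. by rewrite lt_neqAle enorm_ge0 eq_sym enorm_eq0 andbT. Qed.

(** Cauchy-Schwarz: with [a], [b] the norms of [u], [v] and [c] their product, the vector
    [b *: u - a *: v] has squared norm [2 * a * b * (a * b - c)]. *)
Lemma dotv_le_enorm u v : dotv u v <= enorm u * enorm v.
Proof.
have [->|u0] := eqVneq u 0.
  by rewrite enorm0 mul0r -(scale0r 0) dotvZl mul0r.
have [->|v0] := eqVneq v 0.
  by rewrite enorm0 mulr0 -(scale0r 0) dotvZr mul0r.
have a0 : 0 < enorm u by rewrite enorm_gt0.
have b0 : 0 < enorm v by rewrite enorm_gt0.
have := dotvv_ge0 (enorm v *: u - enorm u *: v).
rewrite !(dotvDl, dotvDr, dotvNl, dotvNr, dotvZl, dotvZr).
rewrite -!sqr_enorm (dotvC v u).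
move: (enorm u) (enorm v) (dotv u v) a0 b0 => a b c a0 b0 h.
have : 0 <= (2 * a * b) * (a * b - c) by nra.
by rewrite pmulr_rge0 ?subr_ge0 // !mulr_gt0.
Qed.

Lemma parallelogram u v :
  enorm (u + v) ^+ 2 + enorm (u - v) ^+ 2 = 2 * enorm u ^+ 2 + 2 * enorm v ^+ 2.
Proof. rewrite !sqr_enorm !(dotvDl, dotvDr, dotvNl, dotvNr); ring. Qed.

Lemma normr_le_enorm u : `|u| <= enorm u.
Proof.
rewrite /Num.norm/= mx_normrE; apply: bigmax_le; first exact: enorm_ge0.
by move=> [i j] _ /=; rewrite ord1 coord_le_enorm.
Qed.

Lemma enorm_le_normr u : enorm u <= Num.sqrt n%:R * `|u|.
Proof.
rewrite -[`|u|]ger0_norm // -sqrtr_sqr -sqrtrM ?ler0n // ler_wsqrtr //.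
rewrite mulr_natl -[X in _ *+ X]card_ord -sumr_const; apply: ler_sum => i _.
rewrite -expr2 -real_normK ?num_real // lerXn2r ?nnegrE //.
by rewrite [leRHS]/Num.norm/= mx_normrE; apply: (le_bigmax _ _ (0, i)).
Qed.

End Euclidean.

Lemma convex_functionP (R : realType) (E : lmodType R) (D : set E)
    (f : E -> R) :
  convex_function D f <-> forall t x y, 0 <= t -> t <= 1 -> D x -> D y ->
    f (t *: x + (1 - t) *: y) <= t * f x + (1 - t) * f y.
Proof.
split=> [cf t x y t0 t1 Dx Dy | cf t x y].
  exact: (cf (Itv01 t0 t1) x y (mem_set Dx) (mem_set Dy)).
rewrite !inE => Dx Dy.
exact: (cf t%:num x y (ge0 t) (le1 t)).
Qed.

(** * Moduli of continuity: concavity estimates, inverse, second differences *)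

Section Modulus.
Variables (R : realType) (omega : R -> R).
Hypothesis omegaM : modulus_of_continuity omega.

Lemma modulus_ge0 t : 0 <= t -> 0 <= omega t.
Proof. by case: omegaM => _ _ + _; apply. Qed.

Lemma modulus_lt s t : 0 <= s -> s < t -> omega s < omega t.
Proof.
case: omegaM => _ + _ _ => inc s0 st; apply: inc => //;
  rewrite in_itv/= andbT //.
exact: le_trans (ltW st).
Qed.

Lemma modulus_le s t : 0 <= s -> s <= t -> omega s <= omega t.
Proof.
move=> s0; rewrite le_eqVlt => /predU1P[-> //|st].
by rewrite ltW // modulus_lt.
Qed.

Lemma modulus_gt0 t : 0 < t -> 0 < omega t.
Proof. by move=> t0; apply: le_lt_trans (modulus_lt _ t0);
  rewrite ?modulus_ge0. Qed.

(** Concavity at the weight [(a - t) / (a - b)], with the denominator cleared so that [a = b] is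
    allowed. *)
Lemma modulus_chord b t a : 0 <= b -> b <= t -> t <= a ->
  omega b * (a - t) + omega a * (t - b) <= omega t * (a - b).
Proof.
move=> b0 bt ta; have [ab|ab] := eqVneq a b.
  have -> : t = b by lra.
  by rewrite ab; lra.
have ab0 : 0 < a - b by rewrite subr_gt0 lt_neqAle eq_sym ab (le_trans bt ta).
case: omegaM => + _ _ _ => /convex_functionP /(_ ((a - t) / (a - b)) b a).
have -> : 1 - (a - t) / (a - b) = (t - b) / (a - b) by field; rewrite gt_eqF.
have -> : (a - t) / (a - b) *: (b : R^o) + (t - b) / (a - b) *: (a : R^o) = t.
  by rewrite /GRing.scale/=; field; rewrite gt_eqF.
rewrite /= !in_itv/= !andbT ler_pdivrMr // mul1r divr_ge0 ?(ltW ab0)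
  ?subr_ge0 //.
move=> /(_ isT); rewrite lerB // => /(_ isT b0 (le_trans b0 (le_trans bt ta))).
rewrite !mulrN -opprD lerN2 -(ler_pM2r ab0) mulrDl.
by rewrite [_ / _ * _]mulrAC divfK ?gt_eqF //
  [_ / _ * _]mulrAC divfK ?gt_eqF // !(mulrC (omega _)).
Qed.

(** The chord over [[0, t]], with its nonnegative term in [omega 0] dropped; equivalently,
    [omega t / t] is nonincreasing. *)
Lemma modulus_ratio s t : 0 <= s -> s <= t -> s * omega t <= t * omega s.
Proof.
move=> s0 st; have := modulus_chord (lexx 0) s0 st.
have : 0 <= omega 0 * (t - s) by rewrite mulr_ge0 ?modulus_ge0 ?subr_ge0.
lra.
Qed.

Lemma modulus_small e : 0 < e ->
  exists2 d, 0 < d & forall t, 0 < t -> t < d -> omega t < e.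
Proof.
move=> e0; case: omegaM => _ _ _ /cvgr0_norm_lt /(_ e e0).
rewrite near_withinE => /nbhs_ballP[d /= d0 H]; exists d => // t t0 td.
apply: le_lt_trans (ler_norm _) _; apply: H => //=.
by rewrite /ball/= sub0r normrN gtr0_norm.
Qed.

(** On either side of [x], [modulus_ratio] gives [x * |omega x - omega y| <= |x - y| * omega x]. The
    first entry of the radius keeps [y] positive. *)
Lemma modulus_continuous x : 0 < x -> {for x, continuous omega}.
Proof.
move=> x0; have wx := modulus_gt0 x0.
apply/cvgrPdist_lt => e e0; apply/nbhs_ballP.
exists (Num.min x (e * x / omega x)); first by rewrite /= lt_min x0 !divr_gt0
  ?mulr_gt0.
move=> y; rewrite /ball/= lt_min ltr_pdivlMr // => /andP[yx xye].
have y0 : 0 < y by move: yx; rewrite ltr_distl => /andP[]; lra.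
rewrite -(ltr_pM2r x0); apply: le_lt_trans xye.
have [xy|/ltW yx'] := leP x y.
  rewrite distrC [`|x - y|]distrC !ger0_norm ?subr_ge0 ?modulus_le ?(ltW x0) //.
  have := modulus_ratio (ltW x0) xy; lra.
rewrite !ger0_norm ?subr_ge0 ?modulus_le ?(ltW y0) //.
have := modulus_ratio (ltW y0) yx'; lra.
Qed.

(** Puts an argument of [modulus_inv] in the image of [omega]. Continuity is at hand only away from
    0, so the intermediate value theorem runs on [[s, d]], with [s > 0] so small that
    [omega s < v]. *)
Lemma modulus_ivt d v : 0 <= d -> 0 < v -> v <= omega d ->
  exists2 r, 0 <= r & omega r = v.
Proof.
move=> d0 v0 vd; have [e e0 He] := modulus_small v0.
pose s := e / 2; have s0 : 0 < s by rewrite divr_gt0.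
have sv : omega s < v by apply: He => //; rewrite /s; lra.
have sd : s <= d.
  rewrite leNgt; apply/negP => /(modulus_lt d0) ds; lra.
have cont : {within `[s, d], continuous omega}.
  apply: (@continuous_subspaceW _ _ _ ([set` `]0, +oo[%R] : set R)).
    move=> x /=; rewrite !in_itv/= => /andP[sx _]; rewrite andbT.
    exact: lt_le_trans sx.
  rewrite continuous_open_subspace; last exact: interval_open.
  by move=> x; rewrite inE/= in_itv/= andbT => /modulus_continuous.
have [r] : exists2 r, r \in `[s, d] & omega r = v.
  apply: IVT => //; rewrite min_l ?max_r ?(ltW sv) ?modulus_le ?(ltW s0)//.
by rewrite in_itv/= => /andP[sr _] rv; exists r => //; apply: le_trans sr;
  apply: ltW.
Qed.

Lemma modulus_invK r : 0 <= r -> modulus_inv omega (omega r) = r.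
Proof.
move=> r0; apply: pinvKV; last by rewrite inE /= in_itv/= andbT.
move=> x y; rewrite !inE/= !in_itv/= !andbT => x0 y0 E.
by case: (ltgtP x y) => // /modulus_lt; [move/(_ x0)|move/(_ y0)];
  rewrite E ltxx.
Qed.

(** Meant for [a = |v + h|], [b = |v - h|], [t = |v|], where the identity is the parallelogram law.
    If [t <= h], then [a] and [b] are at most [2 * h], and each term is at most [4 * (h * omega h)].
    If [h < t], [omega] is replaced by an affine majorant touching it at [t], which leaves a
    quadratic estimate. *)
Lemma modulus_second_difference a b t h :
  0 <= a -> 0 <= b -> 0 <= t -> 0 <= h ->
  a ^+ 2 + b ^+ 2 = 2 * t ^+ 2 + 2 * h ^+ 2 ->
  a * omega a + b * omega b <= 2 * (t * omega t) + 8 * (h * omega h).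
Proof.
wlog ba : a b / b <= a.
  move=> W a0 b0 t0 h0 E; case: (leP b a) => [|/ltW] ab; first exact: W.
  by rewrite addrC W // addrC.
move=> a0 b0 t0 h0 E; have [th|ht] := leP t h.
  have w2 : omega (2 * h) <= 2 * omega h.
    have [->|hn0] := eqVneq h 0.
      by rewrite mulr0 mulr_natl mulr2n lerDl modulus_ge0.
    have hp : 0 < h by rewrite lt_neqAle eq_sym hn0.
    by rewrite -(ler_pM2l hp) mulrCA mulrA modulus_ratio //; lra.
  have H c : 0 <= c -> c <= 2 * h -> c * omega c <= 4 * (h * omega h).
    move=> c0 ch; apply: le_trans (_ : 2 * h * (2 * omega h) <= _); last lra.
    apply: ler_pM => //; first exact: modulus_ge0.
    by apply: le_trans w2; apply: modulus_le.
  have tw : 0 <= t * omega t by rewrite mulr_ge0 ?modulus_ge0.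
  have ah : a <= 2 * h.
    have h20 : 0 <= 2 * h by lra.
    rewrite -(@ler_pXn2r _ 2) ?nnegrE //; nra.
  have := H _ a0 ah; have := H _ b0 (le_trans ba ah); lra.
have tp : 0 < t by apply: le_lt_trans ht.
have wt := modulus_ge0 t0.
(* [s] is the slope of a line through [(t, omega t)] above [omega] at [a], [b]. *)
have [s [s0 st wa wb]] : exists s, [/\ 0 <= s, s * t <= omega t,
    omega a <= omega t + s * (a - t) & omega b <= omega t + s * (b - t)].
  (* If [t <= b <= a], the line from the origin serves. Otherwise [b < t < a], and the chord over
     [[t, a]], extended to the left, stays above [omega]. *)
  have [bt|tb] := ltP b t; last first.
    have ge c : t <= c -> omega c <= omega t + omega t / t * (c - t).
      move=> tc; rewrite -(ler_pM2l tp).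
      apply: le_trans (modulus_ratio t0 tc) _.
      by rewrite le_eqVlt; apply/orP; left; apply/eqP; field; rewrite gt_eqF.
    exists (omega t / t); split;
      [by rewrite divr_ge0 | by rewrite divfK ?gt_eqF | |].
    + exact: ge (le_trans tb ba).
    + exact: ge.
  have ta : t < a by rewrite ltNge; apply/negP => ta; nra.
  have ta0 : 0 < a - t by rewrite subr_gt0.
  exists ((omega a - omega t) / (a - t)); split.
  - by rewrite divr_ge0 ?subr_ge0 ?(ltW ta) // modulus_le // ltW.
  - rewrite mulrAC ler_pdivrMr //; have := modulus_ratio t0 (ltW ta); lra.
  - by rewrite divfK ?gt_eqF //; lra.
  - rewrite -(ler_pM2r ta0) mulrDl mulrAC divfK ?gt_eqF //.
    have := modulus_chord b0 (ltW bt) (ltW ta); lra.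
rewrite -(ler_pM2l tp).
have amgm : t * (a + b - 2 * t) <= h ^+ 2.
  have := sqr_ge0 (a - t); have := sqr_ge0 (b - t); nra.
have ratio := modulus_ratio h0 (ltW ht).
have wh := modulus_ge0 h0.
have A1 : a * omega a <= a * (omega t + s * (a - t)) by rewrite ler_wpM2l.
have B1 : b * omega b <= b * (omega t + s * (b - t)) by rewrite ler_wpM2l.
have S1 : t * (a * omega a + b * omega b) <=
    t * (a * (omega t + s * (a - t)) + b * (omega t + s * (b - t))).
  by rewrite ler_pM2l //; lra.
have S2 : t * (a + b - 2 * t) * (omega t - s * t) <= h ^+ 2 * (omega t - s * t).
  by rewrite ler_wpM2r // subr_ge0.
have S3 : h * (h * omega t) <= h * (t * omega h) by rewrite ler_wpM2l.
have S4 : h ^+ 2 * (s * t) <= h ^+ 2 * omega t by rewrite ler_wpM2l ?sqr_ge0.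
have S5 : 0 <= t * (h * omega h) by rewrite !mulr_ge0.
have S6 : t * (a * (omega t + s * (a - t)) + b * (omega t + s * (b - t))) =
  2 * t * (t * omega t) + t * (a + b - 2 * t) * (omega t - s * t)
   + s * t * (a ^+ 2 + b ^+ 2 - 2 * t ^+ 2) by ring.
rewrite E in S6; nra.
Qed.

End Modulus.

(** * One-sided directional derivatives of a convex function *)

Section DirectionalDerivative.
Variables (R : realType) (E : lmodType R) (F : E -> R).
Hypothesis F_convex : convex_function setT F.
Implicit Types (x u v h : E) (s t c : R).

Let F_conv t x y : 0 <= t -> t <= 1 ->
  F (t *: x + (1 - t) *: y) <= t * F x + (1 - t) * F y.
Proof. by move=> t0 t1; apply: (convex_functionP _ _).1. Qed.

Definition slope x h t : R := (F (x + t *: h) - F x) / t.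

(** The one-sided derivative at [x] along [h]: slopes are monotone in [t], so this infimum is their
    limit at [0+]. *)
Definition dir_deriv x h : R := inf [set slope x h t | t in `]0, +oo[].

Lemma slope_le x h s t : 0 < s -> s <= t -> slope x h s <= slope x h t.
Proof.
move=> s0 st; have t0 := lt_le_trans s0 st.
have := @F_conv (s / t) (x + t *: h) x.
rewrite divr_ge0 ?(ltW s0) ?(ltW t0) // ler_pdivrMr // mul1r st.
rewrite scalerDr addrAC -scalerDl addrC scalerA divfK ?gt_eqF // subrKC scale1r.
rewrite addrC => /(_ isT isT) H.
rewrite /slope ler_pdivrMr // mulrAC ler_pdivlMr //.
set k := s / t in H.
have -> : (F (x + t *: h) - F x) * s = (F (x + t *: h) - F x) * k * t.
  by rewrite -mulrA divfK ?gt_eqF.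
rewrite ler_pM2r //; lra.
Qed.

(** The point [x] is the combination of [x + t *: h] and [x - h] with weights [1 / (1 + t)] and
    [t / (1 + t)]. This makes the infimum in [dir_deriv] finite. *)
Lemma slope_ge x h t : 0 < t -> F x - F (x - h) <= slope x h t.
Proof.
move=> t0; have t1 : 0 < 1 + t by lra.
have := @F_conv (1 + t)^-1 (x + t *: h) (x - h).
have -> : 1 - (1 + t)^-1 = t / (1 + t) by field; rewrite gt_eqF.
rewrite invr_ge0 (ltW t1) invf_le1 // lerDl (ltW t0).
have -> : (1 + t)^-1 *: (x + t *: h) + t / (1 + t) *: (x - h) = x.
  rewrite mulrC -scalerA -scalerDr scalerBr addrACA subrr addr0.
  by rewrite -{1}[x]scale1r -scalerDl scalerA mulVf ?gt_eqF // scale1r.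
move=> /(_ isT isT); rewrite -(ler_pM2r t1) mulrDl mulrAC mulVf ?gt_eqF //
  mul1r.
rewrite [t / _ * _]mulrAC divfK ?gt_eqF // /slope ler_pdivlMr //; lra.
Qed.

Lemma dir_deriv_le x h t : 0 < t -> dir_deriv x h <= slope x h t.
Proof.
move=> t0; apply: ge_inf; last by exists t => //=; rewrite in_itv/= t0.
by exists (F x - F (x - h)) => _ [s /= + <-];
  rewrite in_itv/= andbT => /slope_ge.
Qed.

Lemma le_dir_deriv x h c :
  (forall t, 0 < t -> c <= slope x h t) -> c <= dir_deriv x h.
Proof.
move=> H; apply: lb_le_inf.
  by exists (slope x h 1), 1 => //=; rewrite in_itv/= ltr01.
by move=> _ [t /= + <-]; rewrite in_itv/= andbT => /H.
Qed.

Lemma slope_near x h e : 0 < e ->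
  exists2 t0, 0 < t0 &
    forall t, 0 < t -> t <= t0 -> slope x h t < dir_deriv x h + e.
Proof.
move=> e0; have : dir_deriv x h < dir_deriv x h + e by rewrite ltrDl.
move=> /inf_lt[|_ [t0 /= + <-] H].
  by exists (slope x h 1), 1 => //=; rewrite in_itv/= ltr01.
rewrite in_itv/= andbT => t00; exists t0 => // t tp tt.
exact: le_lt_trans (slope_le _ _ tp tt) H.
Qed.

(** The midpoint of [x + r *: u] and [x + r *: v] is [x + (r / 2) *: (u + v)]. *)
Lemma dir_derivD x u v : dir_deriv x (u + v) <= dir_deriv x u + dir_deriv x v.
Proof.
apply/ler_addgt0Pr => e e0; have e20 : 0 < e / 2 by lra.
have [s s0 Hs] := slope_near x u e20; have [t t0 Ht] := slope_near x v e20.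
pose r := Num.min s t; have r0 : 0 < r by rewrite lt_min s0.
have /Hs : r <= s by rewrite ge_min lexx.
have /Ht : r <= t by rewrite ge_min lexx orbT.
move=> /(_ r0) H1 /(_ r0) H2; have r20 : 0 < r / 2 by lra.
have H3 := dir_deriv_le x (u + v) r20.
have H : slope x (u + v) (r / 2) <= slope x u r + slope x v r.
  rewrite /slope; have := @F_conv (1 / 2) (x + r *: u) (x + r *: v).
  have -> : (1 / 2) *: (x + r *: u) + (1 - 1 / 2) *: (x + r *: v) =
      x + (r / 2) *: (u + v).
    rewrite !scalerDr !scalerA addrACA -scalerDl.
    have -> : (1 / 2 + (1 - 1 / 2) : R) = 1 by lra.
    by rewrite scale1r; congr (_ + (_ *: _ + _ *: _)); lra.
  move=> /(_ _ _) H; rewrite -mulrDl ler_pdivrMr //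
    [leRHS]mulrA divfK ?gt_eqF //.
  by have := H _ _; lra.
lra.
Qed.

Lemma dir_derivZ_le x h c : 0 < c -> dir_deriv x (c *: h) <= c * dir_deriv x h.
Proof.
move=> c0; rewrite mulrC -ler_pdivrMr //; apply: le_dir_deriv => t t0.
rewrite ler_pdivrMr //; have tc : 0 < t / c by rewrite divr_gt0.
apply: le_trans (dir_deriv_le _ _ tc) _.
by rewrite /slope scalerA divfK ?gt_eqF // invf_div mulrA mulrAC.
Qed.

Lemma dir_derivZ x h c : 0 < c -> dir_deriv x (c *: h) = c * dir_deriv x h.
Proof.
move=> c0; apply/eqP; rewrite eq_le dir_derivZ_le //= -ler_pdivlMl //.
apply: le_trans (dir_derivZ_le _ _ _); rewrite ?invr_gt0 //.
by rewrite scalerA mulVf ?gt_eqF // scale1r.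
Qed.

Lemma dir_deriv0 x : dir_deriv x 0 = 0.
Proof.
have s0 t : slope x 0 t = 0 by rewrite /slope scaler0 addr0 subrr mul0r.
apply: le_anti; apply/andP; split; last by apply: le_dir_deriv => t _;
  rewrite s0.
by rewrite -[leRHS](s0 1) dir_deriv_le.
Qed.

End DirectionalDerivative.

(** The bound makes the remainder a little-o of [h], and a continuous linear map with such a
    remainder is the differential. *)
Lemma is_diff_of_le (R : realType) (V W : normedModType R) (f : V -> W)
    (df : {linear V -> W}) (x : V) :
  continuous df ->
  (forall e, 0 < e -> \forall h \near 0,
    `|f (h + x) - (f x + df h)| <= e * `|h|) ->
  is_diff x f df.
Proof.
move=> dfc H.
have fE : f \o shift x = cst (f x) + df +o_ 0 id by apply/eqaddoP.
have dE : 'd f x = df :> (V -> W) by apply: diff_unique.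
by split; [apply/diff_locallyP; rewrite dE | exact: dE].
Qed.

(** * Differentiability from convexity and a second-difference bound *)

Section Differentiability.
Variables (R : realType) (n : nat) (omega : R -> R) (A : R) (F : 'rV[R]_n -> R).
Hypothesis omegaM : modulus_of_continuity omega.
Hypothesis A_ge0 : 0 <= A.
Hypothesis F_convex : convex_function setT F.
Hypothesis F_semiconcave : forall x h,
  F (x + h) + F (x - h) <= 2 * F x + A * (enorm h * omega (enorm h)).
Implicit Types (x y u v h : 'rV[R]_n).

(** The sum of the derivatives along [h] and [- h] is nonnegative by subadditivity. It is at most
    [A * |h| * omega (t * |h|)] for every [t > 0], which tends to 0. *)
Lemma dir_derivN x h : dir_deriv F x (- h) = - dir_deriv F x h.
Proof.
apply/eqP; rewrite -addr_eq0 eq_le; apply/andP; split; last first.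
  by rewrite -(dir_deriv0 F_convex x) -(subrr h) addrC dir_derivD.
have [->|h0] := eqVneq h 0; first by rewrite oppr0 (dir_deriv0 F_convex) addr0.
apply/ler_addgt0Pr => e e0; rewrite add0r.
have hp : 0 < enorm h by rewrite enorm_gt0.
have Ah : 0 < A * enorm h + 1 by rewrite ltr_wpDl // mulr_ge0 // ltW.
have /(modulus_small omegaM)[d d0 Hd] : 0 < e / (A * enorm h + 1).
  by rewrite divr_gt0.
pose t := d / 2 / enorm h; have t0 : 0 < t by rewrite !divr_gt0.
have th : t * enorm h = d / 2 by rewrite divfK ?gt_eqF.
have /Hd : 0 < d / 2 by lra.
have /[swap]/[apply] : d / 2 < d by lra.
rewrite ltr_pdivlMr // => Hw; have w0 : 0 <= omega (d / 2) by
  rewrite modulus_ge0 //; lra.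
have := dir_deriv_le F_convex x h t0; have := dir_deriv_le F_convex x (- h) t0.
suff : slope F x (- h) t + slope F x h t <= e by lra.
rewrite -mulrDl ler_pdivrMr // scalerN.
have := F_semiconcave x (t *: h); rewrite enormZ gtr0_norm // {2}th.
have : t * (omega (d / 2) * (A * enorm h)) <= t * e by rewrite ler_pM2l //; lra.
lra.
Qed.

(** Subadditivity applied to [- u] and [- v] gives the reverse inequality, the derivative being
    odd. *)
Lemma dir_deriv_additive x u v :
  dir_deriv F x (u + v) = dir_deriv F x u + dir_deriv F x v.
Proof.
apply: le_anti; rewrite dir_derivD //= -[leRHS]opprK -dir_derivN opprD.
by rewrite -lerN2 opprK opprD -!dir_derivN dir_derivD.
Qed.

Lemma dir_deriv_scalable x c h : dir_deriv F x (c *: h) = c * dir_deriv F x h.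
Proof.
case: (ltgtP c 0) => [c0|c0|->]; last by rewrite scale0r mul0r dir_deriv0.
  rewrite -[c]opprK scaleNr dir_derivN dir_derivZ ?oppr_gt0 //; ring.
exact: dir_derivZ.
Qed.

Definition partials x := \row_(i < n) dir_deriv F x (delta_mx 0 i).

Lemma dir_deriv_partials x h : dir_deriv F x h = dotv (partials x) h.
Proof.
rewrite {1}[h]row_sum_delta
  (big_morph _ (dir_deriv_additive x) (dir_deriv0 F_convex x)).
by apply: eq_bigr => i _; rewrite dir_deriv_scalable mxE mulrC.
Qed.

Lemma partials_lower x h : F x + dotv (partials x) h <= F (x + h).
Proof.
have := dir_deriv_le F_convex x h ltr01.
by rewrite dir_deriv_partials /slope scale1r divr1; lra.
Qed.

(** The second-difference bound, with [F (x - h)] estimated from below by the supporting affine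
    function. *)
Lemma partials_upper x h :
  F (x + h) <= F x + dotv (partials x) h + A * (enorm h * omega (enorm h)).
Proof.
by have := F_semiconcave x h; have := partials_lower x (- h); rewrite dotvNr;
  lra.
Qed.

Lemma partials_modulus x y :
  enorm (partials x - partials y) <= 2 * A * omega (enorm (x - y)).
Proof.
set u := partials x - partials y.
have w0 : 0 <= 2 * A * omega (enorm (x - y)).
  by rewrite !mulr_ge0 // modulus_ge0 // enorm_ge0.
have [->|u0] := eqVneq u 0; first by rewrite enorm0.
have [xy|xy] := eqVneq x y; first by move: u0; rewrite /u xy subrr eqxx.
have up : 0 < enorm u by rewrite enorm_gt0.
have dp : 0 < enorm (x - y) by rewrite enorm_gt0 subr_eq0.
have dN : enorm (y - x) = enorm (x - y) by rewrite -enormN opprB.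
rewrite -(ler_pM2l dp); set d := enorm (x - y) in w0 dp dN *.
(* A test vector of length [d = |x - y|] along the difference [u] of the gradients. The value
   [F (y + h)] is bounded above from [y] and below from [x], and [F y] above from [x]; summing,
   [d * |u| <= 2 * A * (d * omega d)]. *)
pose h := (d / enorm u) *: u.
have hd : enorm h = d by rewrite enormZ gtr0_norm ?divr_gt0 // divfK ?gt_eqF.
have uh : dotv u h = d * enorm u.
  by rewrite dotvZr -sqr_enorm expr2 mulrA divfK ?gt_eqF.
have := partials_upper y h; have := partials_lower x (y - x + h).
have := partials_upper x (y - x); rewrite [x + (_ + h)]addrA !subrKC dN hd
  [dotv _ (_ + h)]dotvDr.
move: uh; rewrite {1}/u dotvDl dotvNl; lra.
Qed.

Lemma partials_continuous : continuous partials.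
Proof.
move=> x; apply/(@cvgrPdist_lt _ _ _ (nbhs x)) => e e0.
have Ap : 0 < 2 * A + 1 by rewrite ltr_wpDl ?mulr_ge0.
have /(modulus_small omegaM)[d d0 Hd] : 0 < e / (2 * A + 1) by rewrite divr_gt0.
(* The added 1 keeps the factor positive when [n = 0]. *)
have np : 0 < Num.sqrt n%:R + 1 :> R by rewrite ltr_wpDl ?sqrtr_ge0.
apply/nbhs_ballP; exists (d / (Num.sqrt n%:R + 1));
  first by rewrite /= divr_gt0.
move=> y; rewrite -ball_normE /= ltr_pdivlMr // => xyd.
(* The case [y = x] is apart because [modulus_small] covers positive arguments only. *)
have [->|xy] := eqVneq y x; first by rewrite subrr normr0.
apply: le_lt_trans (normr_le_enorm _) _.
apply: le_lt_trans (partials_modulus _ _) _.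
have xy0 : 0 < enorm (x - y) by rewrite enorm_gt0 subr_eq0 eq_sym.
have /(Hd _ xy0) : enorm (x - y) < d.
  apply: le_lt_trans (enorm_le_normr _) _.
  by apply: le_lt_trans xyd; rewrite mulrC ler_wpM2l // lerDl.
rewrite ltr_pdivlMr //; have := modulus_gt0 omegaM xy0; lra.
Qed.

Fact dotv_linear (u : 'rV[R]_n) : linear (dotv u : 'rV[R]_n -> R).
Proof. by move=> c v w; rewrite dotvDr dotvZr. Qed.

Lemma dotv_continuous u : continuous (dotv u).
Proof.
move=> x; apply/(@cvgrPdist_lt _ _ _ (nbhs x)) => e e0.
have np : 0 < enorm u * Num.sqrt n%:R + 1 :> R.
  by rewrite ltr_wpDl ?mulr_ge0 ?sqrtr_ge0.
apply/nbhs_ballP; exists (e / (enorm u * Num.sqrt n%:R + 1));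
  first by rewrite /= divr_gt0.
move=> y; rewrite -ball_normE /= ltr_pdivlMr // => xye.
rewrite -dotvNr -dotvDr.
have B v : dotv u v <= enorm u * (Num.sqrt n%:R * `|v|).
  apply: le_trans (dotv_le_enorm _ _) _.
  by rewrite ler_wpM2l ?enorm_ge0 // enorm_le_normr.
apply: le_lt_trans xye;
apply: (@le_trans _ _ (enorm u * (Num.sqrt n%:R * `|x - y|))).
  by rewrite ler_norml B andbT lerNl -dotvNr -[`|x - y|]normrN B.
by rewrite mulrA mulrC ler_wpM2l // lerDl.
Qed.

(** The first-order remainder lies between 0 and [A * (|h| * omega |h|)], which is a little-o of
    [h]. *)
Lemma is_diff_partials x : is_diff x F (dotv (partials x)).
Proof.
pose dF : {linear 'rV[R]_n -> R} :=
  HB.pack (dotv (partials x) : 'rV[R]_n -> R)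
    (GRing.isLinear.Build _ _ _ _ _ (dotv_linear (partials x))).
apply: (@is_diff_of_le _ _ _ F dF); first exact: dotv_continuous.
move=> e e0.
have np : 0 < A * Num.sqrt n%:R + 1 by rewrite ltr_wpDl ?mulr_ge0 ?sqrtr_ge0.
have /(modulus_small omegaM)[d d0 Hd] : 0 < e / (A * Num.sqrt n%:R + 1).
  by rewrite divr_gt0.
have np1 : 0 < Num.sqrt n%:R + 1 :> R by rewrite ltr_wpDl ?sqrtr_ge0.
apply/nbhs_ballP; exists (d / (Num.sqrt n%:R + 1));
  first by rewrite /= divr_gt0.
move=> h; rewrite -ball_normE /= sub0r normrN ltr_pdivlMr // => hd.
rewrite [h + x]addrC ger0_norm ?subr_ge0 ?partials_lower //.
apply: (@le_trans _ _ (A * (enorm h * omega (enorm h)))).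
  by rewrite lerBlDl partials_upper.
have [->|h0] := eqVneq h 0; first by rewrite enorm0 mul0r mulr0 normr0 mulr0.
have hp : 0 < enorm h by rewrite enorm_gt0.
have /(Hd _ hp) : enorm h < d.
  apply: le_lt_trans (enorm_le_normr _) _.
  by apply: le_lt_trans hd; rewrite mulrC ler_wpM2l // lerDl.
rewrite ltr_pdivlMr // => we; have w0 := modulus_gt0 omegaM hp.
apply: (@le_trans _ _ (A * (Num.sqrt n%:R * `|h| * omega (enorm h)))).
  by rewrite ler_wpM2l // ler_wpM2r ?(ltW w0) // enorm_le_normr.
rewrite mulrAC !mulrA ler_wpM2r //; lra.
Qed.

Lemma gradient_partials : gradient F = partials.
Proof.
apply/funext => x; apply/rowP => i; rewrite !mxE.
have H := is_diff_partials x.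
by rewrite deriveE // diff_val dir_deriv_partials.
Qed.

End Differentiability.

(** * The convex envelope of a family of functions *)

Section ConvexEnvelope.
Variables (R : realType) (E : lmodType R) (U : set (E -> R)).
Implicit Types (x h : E) (u c : E -> R).

Definition convex_minorant c :=
  convex_function setT c /\ forall u x, U u -> c x <= u x.

(** The two hypotheses that follow make each set nonempty and bounded above, so that [sup] does not
    take its default value. *)
Definition convex_envelope x : R := sup [set c x | c in convex_minorant].

Hypothesis U_neq0 : U !=set0.
Hypothesis minorant_neq0 : convex_minorant !=set0.

Lemma convex_envelope_le u x : U u -> convex_envelope x <= u x.
Proof.
move=> Uu; apply: ge_sup; last by move=> _ [c [_ cU] <-]; apply: cU.
by case: minorant_neq0 => c mc; exists (c x), c.
Qed.

Lemma le_convex_envelope c x : convex_minorant c -> c x <= convex_envelope x.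
Proof.
move=> mc; case: U_neq0 => u Uu; apply: ub_le_sup; last by exists c.
by exists (u x) => _ [d [_ dU] <-]; apply: dU.
Qed.

Lemma convex_envelope_convex : convex_function setT convex_envelope.
Proof.
apply/convex_functionP => t x y t0 t1 _ _; apply: ge_sup.
  case: minorant_neq0 => c mc.
  by exists (c (t *: x + (1 - t) *: y)), c.
move=> _ [c mc <-]; have [/convex_functionP cc _] := mc.
apply: le_trans (cc t x y t0 t1 I I) _.
by apply: lerD; rewrite ler_wpM2l ?subr_ge0 // le_convex_envelope.
Qed.

(* [(F (x + h) + F (x - h) - m) / 2], with [F] the envelope, is itself a convex
   minorant. *)
Lemma convex_envelope_semiconcave h (m : R) :
  (forall u x, U u -> u (x + h) + u (x - h) <= 2 * u x + m) ->
  forall x, convex_envelope (x + h) + convex_envelope (x - h)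
    <= 2 * convex_envelope x + m.
Proof.
move=> Um x.
pose c z := (convex_envelope (z + h) + convex_envelope (z - h) - m) / 2.
suff cU : convex_minorant c by have := le_convex_envelope x cU; rewrite /c; lra.
split.
- apply/convex_functionP => t y z t0 t1 _ _.
  have /convex_functionP F := convex_envelope_convex.
  have shift w : t *: y + (1 - t) *: z + w = t *: (y + w) + (1 - t) *: (z + w).
    by rewrite !scalerDr addrACA -scalerDl subrKC scale1r.
  have := F t (y + h) (z + h) t0 t1 I I; have := F t (y - h) (z - h) t0 t1 I I.
  rewrite -!shift /c; lra.
- move=> u z Uu; have := Um u z Uu.
  have := convex_envelope_le (z + h) Uu; have := convex_envelope_le (z - h) Uu.
  rewrite /c; lra.
Qed.

End ConvexEnvelope.

(** Put [K = 2 / eta * M]. If [a <= K * omega t], the first term suffices. Otherwise [omega t < a /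
    K = eta * omega r <= omega (eta * r)] by concavity, so [t <= eta * r] and the second term
    suffices. *)
Lemma modulus_young (R : realType) (omega : R -> R) (eta M a t r : R) :
  modulus_of_continuity omega -> 0 < eta -> eta <= 1 -> 0 < M ->
  0 <= a -> 0 <= t -> 0 <= r -> omega r = 1 / (2 * M) * a ->
  a * t <= 2 / eta * M * (t * omega t) + eta * a * r.
Proof.
move=> omegaM eta0 eta1 M0 a0 t0 r0 wr.
have w0 := modulus_ge0 omegaM t0.
have [aw|wa] := leP a (2 / eta * M * omega t).
  have H : a * t <= 2 / eta * M * omega t * t by rewrite ler_wpM2r.
  have : 0 <= eta * a * r by rewrite !mulr_ge0 // ltW.
  lra.
have tr : t <= eta * r.
  rewrite leNgt; apply/negP => rt.
  have er0 : 0 <= eta * r by rewrite mulr_ge0 // ltW.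
  have H1 := modulus_lt omegaM er0 rt.
  have H2 : eta * omega r <= omega (eta * r).
    have [->|rn0] := eqVneq r 0.
      rewrite mulr0 -[leRHS]mul1r ler_wpM2r //.
      by rewrite modulus_ge0.
    have rp : 0 < r by rewrite lt_neqAle eq_sym rn0.
    rewrite -(ler_pM2l rp) mulrCA mulrA.
    by apply: modulus_ratio => //; rewrite ler_piMl.
  have H3 : eta * omega r = a / (2 / eta * M).
    by rewrite wr; field; rewrite !gt_eqF.
  have K0 : 0 < 2 / eta * M by rewrite mulr_gt0 ?divr_gt0.
  have : omega t < a / (2 / eta * M) by rewrite ltr_pdivlMr // mulrC.
  by rewrite -H3 => H4; have := lt_trans H1 (lt_le_trans H4 H2); rewrite ltxx.
have H : a * t <= a * (eta * r) by rewrite ler_wpM2l.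
have : 0 <= 2 / eta * M * (t * omega t).
  by rewrite !mulr_ge0 ?invr_ge0 ?(ltW eta0) ?(ltW M0).
lra.
Qed.

(** * Finiteness and positivity of the seminorm of [G] *)

Section Seminorm.
Variables (R : realType) (n : nat) (omega : R -> R).
Variables (C : set 'rV[R]_n) (G : 'rV[R]_n -> 'rV[R]_n).
Hypothesis omegaM : modulus_of_continuity omega.

Lemma modulus_seminorm_le (L : R) :
  (forall x y, C x -> C y -> enorm (G x - G y) <= L * omega (enorm (x - y))) ->
  (modulus_seminorm omega C G <= L%:E)%E.
Proof.
move=> GL; apply: ge_ereal_sup => _ [x [y [Cx Cy xy ->]]].
rewrite lee_fin ler_pdivrMr ?GL //.
by apply: modulus_gt0 => //; rewrite enorm_gt0 subr_eq0.
Qed.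

Hypothesis G_modulus : has_modulus omega C G.
Hypothesis G_nonconstant : exists x y, [/\ C x, C y & G x != G y].
Let M := fine (modulus_seminorm omega C G).

(** The supremum lies between a real ratio and the constant of [G_modulus], so it is finite and
    [fine] preserves it. *)
Let ratio_le_M x y : C x -> C y -> x != y ->
  enorm (G x - G y) / omega (enorm (x - y)) <= M.
Proof.
move=> Cx Cy xy; have [L L0 GL] := G_modulus.
have ub : ((enorm (G x - G y) / omega (enorm (x - y)))%:E
    <= modulus_seminorm omega C G)%E.
  by apply: ereal_sup_ubound; exists x, y.
rewrite -lee_fin fineK //; apply/fin_real.
by rewrite (lt_le_trans (ltNyr _) ub) (le_lt_trans (modulus_seminorm_le GL)
  (ltry _)).
Qed.

Lemma modulus_seminormP x y : C x -> C y ->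
  enorm (G x - G y) <= M * omega (enorm (x - y)).
Proof.
move=> Cx Cy; have [->|xy] := eqVneq x y.
  (* Here the left side vanishes, and a pair at which [G] differs shows that [0 <= M]. *)
  have [L L0 GL] := G_modulus; have [a [b [Ca Cb Gab]]] := G_nonconstant.
  have ab : a != b by apply: contraNneq Gab => ->.
  rewrite subrr enorm0 mulr_ge0 ?(modulus_ge0 omegaM) ?enorm_ge0 //.
  apply: le_trans (ratio_le_M Ca Cb ab).
  by rewrite divr_ge0 ?(modulus_ge0 omegaM) ?enorm_ge0.
rewrite -ler_pdivrMr ?ratio_le_M //.
by apply: modulus_gt0 => //; rewrite enorm_gt0 subr_eq0.
Qed.

Lemma modulus_seminorm_gt0 : 0 < M.
Proof.
have [a [b [Ca Cb Gab]]] := G_nonconstant.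
have ab : a != b by apply: contraNneq Gab => ->.
apply: lt_le_trans (ratio_le_M Ca Cb ab).
rewrite divr_gt0 ?enorm_gt0 ?subr_eq0 //.
by apply: modulus_gt0 => //; rewrite enorm_gt0 subr_eq0.
Qed.

End Seminorm.

(** * Construction of the extension *)

Lemma affine_convex (R : realType) (n : nat) (a : R) (u y : 'rV[R]_n) :
  convex_function setT (fun x => a + dotv u (x - y)).
Proof.
apply/convex_functionP => t v w _ _ _ _.
rewrite le_eqVlt; apply/orP; left; apply/eqP.
rewrite !dotvDr !dotvZr !dotvNr; ring.
Qed.

Theorem theorem1p4 (R : realType) (n : nat) (eta : R)
    (eta_gt0 : 0 < eta) (eta_le : eta <= 1 / 2) :
  exists2 k : R, 0 < k &
    forall (omega : R -> R) (C : set 'rV[R]_n)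
      (f : 'rV[R]_n -> R) (G : 'rV[R]_n -> 'rV[R]_n),
      modulus_of_continuity omega ->
      has_modulus omega C G ->
      (exists x y, [/\ C x, C y & G x != G y]) ->
      let M : R := fine (modulus_seminorm omega C G) in
      (forall x y, C x -> C y ->
        eta * enorm (G x - G y) *
          modulus_inv omega (1 / (2 * M) * enorm (G x - G y))
        <= f x - f y - dotv (G y) (x - y)) ->
      exists F : 'rV[R]_n -> R,
        [/\ convex_function setT F,
            C1_modulus omega F,
            (forall x, C x -> F x = f x),
            (forall x, C x -> gradient F x = G x) &
            (modulus_seminorm omega setT (gradient F) <= (k * M)%:E)%E].
Proof.
(* The gradient will have constant [2 * A] with [A = 8 * K] and [K = 2 / eta * M]. *)
exists (32 / eta); first by rewrite divr_gt0.
move=> omega C f G omegaM Gmod Gnc M fG.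
have M0 : 0 < M := modulus_seminorm_gt0 omegaM Gmod Gnc.
have GM x y : C x -> C y -> enorm (G x - G y) <= M * omega (enorm (x - y)).
  exact: modulus_seminormP.
pose K := 2 / eta * M; have K0 : 0 < K by rewrite mulr_gt0 ?divr_gt0.
pose lower y x := f y + dotv (G y) (x - y).
pose upper y x := lower y x + K * (enorm (x - y) * omega (enorm (x - y))).
(* The difference [lower z x - lower y x] is [<G z - G y, x - y>] minus the quantity that [fG y z]
   bounds below. Cauchy-Schwarz and the Young-type inequality then apply. *)
have lower_upper x y z : C y -> C z -> lower z x <= upper y x.
  move=> Cy Cz; have := fG y z Cy Cz.
  set a := enorm (G y - G z); set t := enorm (x - y).
  have a0 : 0 <= a := enorm_ge0 _.
  have t0 : 0 <= t := enorm_ge0 _.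
  have wt : 0 <= omega t := modulus_ge0 omegaM t0.
  (* If [a = 0], the value of [modulus_inv] is multiplied by 0. If [a > 0], [GM] puts its argument
     in the image of [omega], so no junk value enters. *)
  have [r r0 wr] : exists2 r, 0 <= r & a = 0 \/ omega r = 1 / (2 * M) * a.
    have [an0|an0] := eqVneq a 0; first by exists 0 => //; left.
    have ap : 0 < a by rewrite lt_neqAle eq_sym an0.
    have [|||r r0 wr] := @modulus_ivt _ _ omegaM (enorm (y - z))
      (1 / (2 * M) * a).
    - exact: enorm_ge0.
    - by rewrite mulr_gt0 ?divr_gt0 ?mulr_gt0.
    - rewrite mul1r mulrC ler_pdivrMr ?mulr_gt0 //.
      have := GM y z Cy Cz; have := modulus_ge0 omegaM (enorm_ge0 (y - z)).
      rewrite -/a; nra.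
    by exists r => //; right.
  have young : a * t <= K * (t * omega t)
      + eta * a * modulus_inv omega (1 / (2 * M) * a).
    case: wr => [->|wr].
      by rewrite mul0r mulr0 mul0r addr0 mulr_ge0 ?(ltW K0) // mulr_ge0.
    rewrite -wr modulus_invK //; apply: modulus_young wr => //; lra.
  have := dotv_le_enorm (G z - G y) (x - y).
  rewrite -(enormN (G z - G y)) opprB -/a -/t.
  rewrite /upper /lower -/t !dotvDl !dotvNl !dotvDr !dotvNr; lra.
pose U : set ('rV[R]_n -> R) := [set u | exists2 y, C y & u = upper y].
have lower_minorant z : C z -> convex_minorant U (lower z).
  by move=> Cz; split=> [|_ x [y Cy ->]];
    [exact: affine_convex | exact: lower_upper].
have [y0 Cy0] : exists y, C y by case: Gnc => y [_ [Cy _ _]]; exists y.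
have U0 : U !=set0 by exists (upper y0), y0.
have m0 : convex_minorant U !=set0 by exists (lower y0); apply: lower_minorant.
pose F := convex_envelope U.
have F_convex : convex_function setT F := convex_envelope_convex U0 m0.
have lowerF z x : C z -> lower z x <= F x.
  by move=> Cz; apply: le_convex_envelope => //; apply: lower_minorant.
have Ff x : C x -> F x = f x.
  (* Both [lower x] and [upper x] equal [f x] at [x], and [F] lies between them. *)
  move=> Cx; have lx : lower x x = f x.
    by rewrite /lower subrr -(scale0r 0) dotvZr mul0r addr0.
  apply: le_anti; rewrite -{2}lx lowerF // andbT.
  have -> : f x = upper x x by rewrite /upper lx subrr enorm0 mul0r mulr0 addr0.
  by apply: convex_envelope_le => //; exists x.
pose A := 8 * K; have A0 : 0 <= A by rewrite mulr_ge0 // ltW.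
(* The affine parts of the upper functions cancel in second differences, which leaves [K] times the
   estimate for [|v| * omega |v|]. *)
have F_semiconcave x h :
    F (x + h) + F (x - h) <= 2 * F x + A * (enorm h * omega (enorm h)).
  apply: convex_envelope_semiconcave => // _ z [y Cy ->].
  have := modulus_second_difference omegaM (enorm_ge0 (z - y + h))
    (enorm_ge0 (z - y - h)) (enorm_ge0 (z - y)) (enorm_ge0 h)
    (parallelogram _ _).
  rewrite -(ler_pM2l K0) /upper /lower /A (addrAC z h) (addrAC z (- h)).
  rewrite !(dotvDr _ (z - y)) dotvNr; lra.
have Fgrad := gradient_partials omegaM A0 F_convex F_semiconcave.
have grad_modulus x y : enorm (gradient F x - gradient F y)
    <= 2 * A * omega (enorm (x - y)).
  by rewrite Fgrad; apply: partials_modulus.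
exists F; split => //.
- split.
  + by move=> x; have := is_diff_partials omegaM A0 F_convex F_semiconcave x.
  + by rewrite Fgrad; apply: partials_continuous F_semiconcave.
  + by exists (2 * A) => [|x y _ _]; [rewrite mulr_ge0 | exact: grad_modulus].
(* The affine function [lower x] supports [F] at [x], so [<G x, h>] is at most the derivative along
   [h]. Both are odd in [h], which forces equality. *)
- move=> x Cx; have Gle h : dotv (G x) h <= dir_deriv F x h.
    apply: le_dir_deriv => t t0; rewrite /slope ler_pdivlMr //.
    have := lowerF x (x + t *: h) Cx; rewrite /lower [x + _]addrC addrK dotvZr
      (Ff x) //; lra.
  apply/rowP => i; rewrite Fgrad mxE; apply: le_anti.
  rewrite -(dotv_delta (G x)) Gle andbT -lerN2 -dotvNr.
  by rewrite -(dir_derivN omegaM A0 F_convex F_semiconcave).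
- apply: modulus_seminorm_le => // x y _ _.
  by apply: le_trans (grad_modulus x y) _; rewrite /A /K; lra.
Qed.
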